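(* Let $k$ be a field of characteristic zero. Any proper subvariety $\mathfrak{M}$ of the variety of dual Leibniz algebras over $k$ is nilpotent, i.e. there exists a natural number $N\ge 1$ such that in every algebra $A\in\mathfrak{M}$ every product of $N$ elements of $A$, with any arrangement of parentheses, equals zero.
   Context: An algebra over a field $k$ is a $k$-vector space with a bilinear multiplication (not necessarily associative or unital). A dual Leibniz algebra (also called a Zinbiel algebra) over $k$ is an algebra $A$ over $k$ satisfying the identity $(xy)z=x(zy+yz)$ for all $x,y,z\in A$. A variety of algebras over $k$ is the class of all algebras over $k$ satisfying a given set of identities (nonassociative polynomials over $k$ without constant term, required to vanish under all substitutions of elements of the algebra). A subvariety of a variety is a variety contained in it; it is proper if it is not equal to the whole variety. *)

(* Defs.v *)
From HB Require Import structures.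
From mathcomp Require Import all_boot all_order all_algebra.
From mathcomp Require Import sesquilinear finmap monalg.

Set Implicit Arguments.
Unset Strict Implicit.
Unset Printing Implicit Defensive.

Import GRing.Theory.
Local Open Scope ring_scope.

(* The free magma on T: a parenthesised nonempty product of elements of T. *)
Inductive fmagma (T : Type) : Type :=
  | FLeaf of T
  | FMul of fmagma T & fmagma T.

Fixpoint fmagma_map (T U : Type) (f : T -> U) (w : fmagma T) : fmagma U :=
  match w with
  | FLeaf x => FLeaf (f x)
  | FMul w1 w2 => FMul (fmagma_map f w1) (fmagma_map f w2)
  end.

Fixpoint fmagma_size (T : Type) (w : fmagma T) : nat :=
  match w with
  | FLeaf _ => 1
  | FMul w1 w2 => fmagma_size w1 + fmagma_size w2
  end%N.

Fixpoint fmagma_tree (T : Type) (w : fmagma T) : GenTree.tree T :=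
  match w with
  | FLeaf x => GenTree.Leaf x
  | FMul w1 w2 => GenTree.Node 0 [:: fmagma_tree w1; fmagma_tree w2]
  end.

Fixpoint tree_fmagma (T : Type) (t : GenTree.tree T) : option (fmagma T) :=
  match t with
  | GenTree.Leaf x => Some (FLeaf x)
  | GenTree.Node 0 [:: t1; t2] =>
      if (tree_fmagma t1, tree_fmagma t2) is (Some w1, Some w2)
      then Some (FMul w1 w2) else None
  | _ => None
  end.

Lemma fmagma_treeK (T : Type) : pcancel (@fmagma_tree T) (@tree_fmagma T).
Proof. by elim=> //= w1 -> w2 ->. Qed.

HB.instance Definition _ (T : choiceType) :=
  Choice.copy (fmagma T) (pcan_type (@fmagma_treeK T)).

Record nalg (k : fieldType) : Type := Nalg {
  nalg_sort :> lmodType k;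
  nalg_mul : {bilinear nalg_sort -> nalg_sort -> nalg_sort}
}.

Fixpoint mprod (k : fieldType) (A : nalg k) (w : fmagma A) : A :=
  match w with
  | FLeaf x => x
  | FMul w1 w2 => nalg_mul A (mprod w1) (mprod w2)
  end.

(* The free nonassociative algebra on countably many variables, as the vector
   space with basis the free magma.  Every monomial has at least one factor,
   so there are no constant terms. *)
Definition napoly (k : fieldType) : Type := {malg k[fmagma nat]}.

Definition naeval (k : fieldType) (A : nalg k) (v : nat -> A) (p : napoly k) : A :=
  \sum_(w <- msupp p) p@_w *: mprod (fmagma_map v w).

Definition satisfies (k : fieldType) (A : nalg k) (p : napoly k) : Prop :=
  forall v : nat -> A, naeval v p = 0.

Definition is_variety (k : fieldType) (V : nalg k -> Prop) : Prop :=
  exists I : napoly k -> Prop,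
    forall A : nalg k, V A <-> (forall p : napoly k, I p -> satisfies A p).

Definition proper_subvariety (k : fieldType) (M V : nalg k -> Prop) : Prop :=
  [/\ is_variety M,
      forall A : nalg k, M A -> V A
    & ~ (forall A : nalg k, V A <-> M A)].

Definition dual_leibniz (k : fieldType) (A : nalg k) : Prop :=
  forall x y z : A,
    nalg_mul A (nalg_mul A x y) z
      = nalg_mul A x (nalg_mul A z y + nalg_mul A y z).

Definition nilpotent_variety (k : fieldType) (M : nalg k -> Prop) : Prop :=
  exists2 N : nat, (1 <= N)%N &
    forall A : nalg k, M A ->
      forall w : fmagma A, fmagma_size w = N -> mprod w = 0.

Definition dual_leibniz_poly (k : fieldType) : napoly k :=
  let X (i : nat) := FLeaf i in
  << FMul (FMul (X 0) (X 1)) (X 2) >>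
  - << FMul (X 0) (FMul (X 2) (X 1)) >>
  - << FMul (X 0) (FMul (X 1) (X 2)) >>.

Lemma naeval_sub (k : fieldType) (A : nalg k) (v : nat -> A)
    (d : {fset fmagma nat}) (p : napoly k) : (msupp p `<=` d)%fset ->
  naeval v p = \sum_(w <- d) p@_w *: mprod (fmagma_map v w).
Proof.
move=> sub; rewrite /naeval (big_fset_incl _ sub) // => w _ w0.
by rewrite mcoeff_outdom // scale0r.
Qed.

Lemma naevalU (k : fieldType) (A : nalg k) (v : nat -> A) (w : fmagma nat) :
  naeval v << w >> = mprod (fmagma_map v w).
Proof.
rewrite (naeval_sub v (msuppU_le)) big_seq_fset1.
by rewrite mcoeffU eqxx mulr1n scale1r.
Qed.

Lemma naevalB (k : fieldType) (A : nalg k) (v : nat -> A) (p q : napoly k) :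
  naeval v (p - q : napoly k) = naeval v p - naeval v q.
Proof.
rewrite (naeval_sub v (msuppB_le p q)).
rewrite (naeval_sub v (fsubsetUl (msupp p) (msupp q))).
rewrite (naeval_sub v (fsubsetUr (msupp p) (msupp q))) -sumrB.
by apply: eq_bigr => w _; rewrite mcoeffB scalerBl.
Qed.

Lemma dual_leibniz_is_variety (k : fieldType) : is_variety (@dual_leibniz k).
Proof.
exists (eq (dual_leibniz_poly k)) => A; split=> [dlA p <- v | H x y z].
  by rewrite !naevalB !naevalU /= dlA linearDr -addrA -opprD subrr.
have := H _ erefl (fun i => nth x [:: x; y; z] i).
rewrite !naevalB !naevalU /= -addrA -opprD => /eqP.
by rewrite subr_eq0 linearDr => /eqP.
Qed.

(* Main.v *)
Require Import Defs.
From mathcomp Require Import all_boot all_order all_algebra.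
From HB Require Import structures.
From mathcomp Require Import sesquilinear finmap monalg.
From mathcomp Require Import zify ring.
From Stdlib Require Import Classical.

Set Implicit Arguments.
Unset Strict Implicit.
Unset Printing Implicit Defensive.

Import GRing.Theory.
Local Open Scope ring_scope.

(** Write x +* y = xy + yx.  In a dual Leibniz algebra this product is
    associative and commutative, and (xy)z = x(y +* z); hence every product is
    a sum of right-normed words x1(x2(...(x_{m-1} x_m))).  The proof has two
    halves.

    1. A proper subvariety satisfies a nil identity: x +* ... +* x = 0 for a
    fixed number of factors.  The polynomials k[t], with the product
    p . q = p * (integral of q from 0), form a dual Leibniz algebra P.  It
    generates the whole variety [poly_nalg_generates]: an identity is a
    combination of words, a word evaluates in P to an iterated integral, and
    iterated integrals of distinct words are linearly independent as functions
    of the integrands [iter_integ_independent].  So P is outside a proper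
    subvariety, which therefore has an identity with a nonzero value g in P.
    For x in an algebra of the subvariety, t^n |-> (n+1)-st +*-power of x over
    n+1 defines a homomorphism from P [poly_substM]; it kills g, and scaling
    x isolates the top coefficient of g, so that a power of x vanishes
    [nil_of_relation].

    The independence is seen by adding to the integral f_i of the i-th
    integrand a high power t^s.  The part of first order in the perturbation
    has coefficients that are rational functions of s without poles at the
    natural numbers; a relation kills it for large s, hence also at s = 0.
    There the perturbation is the constant 1, which survives only in the
    innermost integral: the relation restricted to the words that end in i,
    with this letter deleted, is again a relation.  Induction on words ends
    the argument.

    2. A nil identity forces nilpotency.  Polarization turns x +* ... +* x = 0
    into the vanishing of all +*-products with one factor more.  Let I_n be the
    left ideal generated by the +*-products of n+1 elements, so that I_0 is the whole
    algebra.  By induction on n, words of length at least 2^(n+1) - 1 lie in I_n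
    [word_power_ideal].  The induction step works modulo I_{n+1} and meets a
    letter x in front of a generator j of I_n.  The element s = xj satisfies
    sv = x(j +* v) = 0 for every v, so a word followed by s equals the product
    of the word by s, and this is 0 as soon as the word belongs to I_n. *)

(** * Characteristic zero and the infinite field *)

Section NatInField.
Variables (k : fieldType) (char0 : [pchar k]%R =i pred0).

Lemma natS_neq0 n : n.+1%:R != 0 :> k.
Proof. by rewrite ((pcharf0P k).1 char0). Qed.

Lemma natr_injective m n : m%:R = n%:R :> k -> m = n.
Proof.
wlog le_mn : m n / (m <= n)%N => [IH e | ].
  by case: (leqP m n) => [/IH|/ltnW /IH] ->.
move=> e; suff : (n - m)%:R = 0 :> k.
  by case D : (n - m)%N => [|d]; [lia | move/eqP; rewrite (negPf (natS_neq0 d))].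
by rewrite natrB // e subrr.
Qed.

(** A Vandermonde argument without determinants: subtracting 2^n times the
    relation at m from the relation at 2m kills the leading term and multiplies
    the others by nonzero constants. *)
Lemma vanishing_coefs (V : lmodType k) n (H : nat -> V) :
    (forall m : nat, \sum_(j < n) m%:R ^+ j *: H j = 0) ->
  forall j, (j < n)%N -> H j = 0.
Proof.
elim: n H => // n IH H H0.
have lt_n j : (j < n)%N -> H j = 0.
  move=> lt_jn; have := IH (fun j => (2 ^+ j - 2 ^+ n) *: H j).
  move=> /(_ _ j lt_jn) /= E.
  have : (2 ^+ j - 2 ^+ n) *: H j = 0 :> V.
    apply: E => m.
    have := congr2 (fun u v => u - 2 ^+ n *: v) (H0 (2 * m)%N) (H0 m).
    rewrite scaler0 subr0 scaler_sumr -sumrB big_ord_recr /=.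
    rewrite natrM exprMn scalerA subrr addr0 => {2}<-.
    apply: eq_bigr => i _; rewrite exprMn !scalerA -scalerBl; congr (_ *: _).
    by ring.
  move/eqP; rewrite scaler_eq0 subr_eq0 => /orP[|/eqP //].
  rewrite -!natrX => /eqP /natr_injective /eqP.
  by rewrite eqn_exp2l // => /eqP; lia.
move=> j; rewrite ltnS leq_eqVlt => /orP[/eqP -> | /lt_n //].
have := H0 1%N; rewrite big_ord_recr big1 /= => [|i _]; last by rewrite lt_n ?scaler0.
by rewrite add0r expr1n scale1r.
Qed.
End NatInField.

(** * The symmetrized product *)

Definition sym_mul (k : fieldType) (A : nalg k) (x y : A) : A :=
  nalg_mul A x y + nalg_mul A y x.

Section SymmetrizedProduct.
Variables (k : fieldType) (A : nalg k) (dlA : dual_leibniz A).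
Local Notation "x ** y" := (nalg_mul A x y) (at level 40, left associativity).
Local Notation "x +* y" := (sym_mul x y) (at level 40, left associativity).
Implicit Types (x y z a b c s v w : A) (xs ys : seq A).

Lemma mul_mul x y z : (x ** y) ** z = x ** (y +* z).
Proof. by rewrite dlA addrC. Qed.

Lemma sym_mulC x y : x +* y = y +* x.
Proof. by rewrite /sym_mul addrC. Qed.

Lemma sym_mulA x y z : x +* (y +* z) = (x +* y) +* z.
Proof.
have E a b c : a +* (b +* c) = a ** (b +* c) + (b ** (c +* a) + c ** (b +* a)).
  by rewrite {1}/sym_mul {3}/sym_mul linearDl /= !mul_mul.
rewrite (sym_mulC (x +* y)) !E (sym_mulC y x) (sym_mulC z x).
by rewrite addrA addrC.
Qed.

Lemma sym_mulCA x y z : x +* (y +* z) = y +* (x +* z).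
Proof. by rewrite !sym_mulA (sym_mulC x y). Qed.

Lemma sym_mulDl x y z : (x + y) +* z = x +* z + y +* z.
Proof. by rewrite /sym_mul linearDl linearDr addrACA. Qed.

Lemma sym_mulDr x y z : z +* (x + y) = z +* x + z +* y.
Proof. by rewrite !(sym_mulC z) sym_mulDl. Qed.

Lemma sym_mulZl l x z : (l *: x) +* z = l *: (x +* z).
Proof. by rewrite /sym_mul linearZl_LR linearZr_LR scalerDr. Qed.

Lemma sym_mulZr l x z : z +* (l *: x) = l *: (z +* x).
Proof. by rewrite !(sym_mulC z) sym_mulZl. Qed.

Lemma sym_mul0r z : z +* 0 = 0.
Proof. by rewrite /sym_mul linear0l linear0r addr0. Qed.

Lemma sym_mul_sumr z (n : nat) (F : 'I_n -> A) :
  z +* (\sum_i F i) = \sum_i z +* F i.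
Proof. exact: (big_morph (sym_mul z) (fun a b => sym_mulDr a b z) (sym_mul0r z)). Qed.

Lemma sym_mul_iter n x y z :
  x +* iter n (sym_mul y) z = iter n (sym_mul y) (x +* z).
Proof. by elim: n => //= n <-; rewrite sym_mulCA. Qed.

(** The binomial expansion of c +* (x + m y)^n, recording only the two
    coefficients of lowest degree in m.  That H vanishes beyond n lets the
    induction step shift the summation range. *)
Lemma iter_sym_mulD n x y c : exists H : nat -> A,
  [/\ forall m : nat, iter n (sym_mul (x + m%:R *: y)) c
        = \sum_(j < n.+1) m%:R ^+ j *: H j,
      forall j, (n < j)%N -> H j = 0,
      H 0%N = iter n (sym_mul x) c
    & H 1%N = n%:R *: (y +* iter n.-1 (sym_mul x) c)].
Proof.
elim: n => [|n [H [Hs Hbig H0 H1]]].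
  exists (fun j => if j is 0 then c else 0); split=> //=; last by rewrite scale0r.
    by move=> m; rewrite big_ord1 scale1r.
  by case.
exists (fun j => x +* H j + (if j is j'.+1 then y +* H j' else 0)); split.
- move=> m; rewrite iterS Hs sym_mulDl sym_mulZl !sym_mul_sumr scaler_sumr.
  under [RHS]eq_bigr do rewrite scalerDr.
  rewrite [RHS]big_split /= [X in _ = X + _]big_ord_recr /= Hbig // sym_mul0r scaler0.
  rewrite addr0 [X in _ = _ + X]big_ord_recl scaler0 add0r.
  congr (_ + _); apply: eq_bigr => i _; first by rewrite sym_mulZr.
  by rewrite sym_mulZr scalerA exprS.
- by case=> // j lt_nj; rewrite !Hbig ?sym_mul0r ?addr0 //; lia.
- by rewrite H0 addr0.
rewrite H1 H0 sym_mulZr; case: n {Hs Hbig H0 H1} => [|n].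
  by rewrite scale0r add0r scale1r.
by rewrite sym_mulCA -[n.+2%:R]natr1 scalerDl scale1r.
Qed.



(** Polarization, one factor at a time: the coefficient of degree 1 in m of the
    relation at x + m y replaces one factor x by y, and y is then absorbed into
    c. *)
Lemma polarization n c : [pchar k]%R =i pred0 ->
    (forall x, iter n (sym_mul x) c = 0) ->
  forall ys, size ys = n -> foldr (@sym_mul k A) c ys = 0.
Proof.
move=> char0; elim: n c => [|n IH] c nil_c ys.
  by move/eqP; rewrite size_eq0 => /eqP ->; exact: nil_c.
case/lastP: ys => // ys y; rewrite size_rcons => -[size_ys].
rewrite -cats1 foldr_cat /=; apply: (IH) size_ys => x.
have [H [Hs _ _ H1]] := iter_sym_mulD n.+1 x y c.
have : H 1%N = 0.
  by apply: (@vanishing_coefs k char0 _ n.+2) => // m; rewrite -Hs nil_c.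
rewrite H1 => /eqP; rewrite scaler_eq0 (negPf (natS_neq0 char0 n)) /=.
by rewrite sym_mul_iter => /eqP.
Qed.

(** * Long words lie in the ideals of products *)

(** The left ideal generated by the (n+1)-fold products for sym_mul. *)
Inductive power_ideal (n : nat) : A -> Prop :=
  | PowerIdealGen c ys of size ys = n :
      power_ideal n (foldr (@sym_mul k A) c ys)
  | PowerIdealD a b of power_ideal n a & power_ideal n b : power_ideal n (a + b)
  | PowerIdealN a of power_ideal n a : power_ideal n (- a)
  | PowerIdealM x a of power_ideal n a : power_ideal n (x ** a).

(** For a generator j of the n-th ideal, js = (s +* j) - sj, and s +* j has one
    factor more than j. *)
Lemma power_ideal_mul_annihilator n w s :
    (forall v, power_ideal n.+1 (s ** v)) ->
  power_ideal n w -> power_ideal n.+1 (w ** s).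
Proof.
move=> Is; elim=> {w} [c ys size_ys | a b _ Ia _ Ib | a _ Ia | x a _ Ia].
- set j := foldr _ _ _.
  have -> : j ** s = s +* j - s ** j by rewrite /sym_mul addrAC subrr add0r.
  apply: PowerIdealD; last exact/PowerIdealN.
  by apply: (@PowerIdealGen _ c (s :: ys)); rewrite /= size_ys.
- by rewrite linearDl; apply: PowerIdealD.
- by rewrite linearNl; apply: PowerIdealN.
- by rewrite mul_mul; apply/PowerIdealM/PowerIdealD.
Qed.

(** When s annihilates the algebra from the left modulo the ideal, the product
    (yb)s = y(bs + sb) is congruent to y(bs): multiplying a word by s on the
    right appends s to the word. *)
Lemma word_mul_annihilator n w ys s :
    (forall v, power_ideal n (s ** v)) ->
  power_ideal n (foldr (nalg_mul A) (w ** s) ys - foldr (nalg_mul A) w ys ** s).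
Proof.
move=> Is; elim: ys => [|y ys IH] /=.
  by rewrite subrr -(linear0r (nalg_mul A) s); apply: Is.
set a := foldr _ _ _ in IH *; set b := foldr _ _ _ in IH *.
have -> : y ** a - y ** b ** s = y ** (a - b ** s) - y ** (s ** b).
  by rewrite mul_mul /sym_mul !linearDr linearNr /= opprD addrA.
by apply: PowerIdealD; [| apply: PowerIdealN]; apply: PowerIdealM.
Qed.

Lemma foldr_mulD xs a b :
  foldr (nalg_mul A) (a + b) xs
    = foldr (nalg_mul A) a xs + foldr (nalg_mul A) b xs.
Proof. by elim: xs => //= x xs ->; rewrite linearDr. Qed.

Lemma foldr_mulN xs a : foldr (nalg_mul A) (- a) xs = - foldr (nalg_mul A) a xs.
Proof. by elim: xs => //= x xs ->; rewrite linearNr. Qed.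

(** The length of the word is (size xs).+1, and f(n) = 2^(n+1) - 1 satisfies
    f(n+1) = 2 f(n) + 1.  A word of length at least f(n+1) is cut into f(n) + 1
    letters followed by at least f(n) others, which form a word in the n-th
    ideal.  The last of the f(n) + 1 letters turns a generator of that ideal
    into a left annihilator, and the f(n) before it also form a word in the
    n-th ideal. *)
Lemma word_power_ideal n xs a :
  (2 ^ n.+1 <= (size xs).+2)%N -> power_ideal n (foldr (nalg_mul A) a xs).
Proof.
elim: n xs a => [|n IHn] xs a size_xs; first exact: (@PowerIdealGen _ _ [::]).
have gt0 : (0 < 2 ^ n)%N by rewrite expn_gt0.
have prefix_annihilator s ys : (forall v, power_ideal n.+1 (s ** v)) ->
    (2 ^ n.+1 <= (size ys).+1)%N -> power_ideal n.+1 (foldr (nalg_mul A) s ys).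
  move=> Is; case/lastP: ys => [|ys y]; first by rewrite expnS /=; lia.
  rewrite size_rcons -cats1 foldr_cat /= => size_ys.
  rewrite -(subrK (foldr (nalg_mul A) y ys ** s) (foldr _ _ _)).
  apply: PowerIdealD; first exact: word_mul_annihilator.
  by apply: power_ideal_mul_annihilator => //; apply: IHn.
have prefix_ideal b ys : power_ideal n b -> (2 ^ n.+1 <= size ys)%N ->
    power_ideal n.+1 (foldr (nalg_mul A) b ys).
  move=> Ib; elim: Ib ys => {b}
    [c zs size_zs | b b' _ Ib _ Ib' | b _ Ib | x b _ Ib] ys size_ys.
  - (* The last letter y of the prefix makes y j a left annihilator. *)
    case/lastP: ys size_ys => [|ys y]; first by rewrite expnS /=; lia.
    rewrite size_rcons -cats1 foldr_cat /= => size_ys.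
    apply: prefix_annihilator => // v; rewrite mul_mul sym_mulC.
    by apply/PowerIdealM/(@PowerIdealGen _ c (v :: zs)); rewrite /= size_zs.
  - by rewrite foldr_mulD; apply: PowerIdealD; [exact: Ib | exact: Ib'].
  - by rewrite foldr_mulN; apply: PowerIdealN; exact: Ib.
  - (* The letter x moves to the prefix. *)
    have := Ib (rcons ys x); rewrite -cats1 foldr_cat; apply.
    by rewrite size_cat; lia.
rewrite -(cat_take_drop (2 ^ n.+1) xs) foldr_cat; apply: prefix_ideal.
  by apply: IHn; rewrite size_drop; move: size_xs; rewrite [(2 ^ n.+2)%N]expnS; lia.
rewrite size_takel //; move: size_xs; rewrite [(2 ^ n.+2)%N]expnS expnS; lia.
Qed.

Inductive word_span : nat -> A -> Prop :=
  | WordLetter x : word_span 1 x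
  | WordCons n x a of word_span n a : word_span n.+1 (x ** a)
  | WordD n a b of word_span n a & word_span n b : word_span n (a + b).

(** Since (xa)b = x(ab + ba) also needs the product ba in the opposite order,
    the induction is on the total length. *)
Lemma word_spanM m n a b :
  word_span m a -> word_span n b -> word_span (m + n) (a ** b).
Proof.
have [N] := ubnP (m + n); elim: N m n a b => // N IHN m n a b lt_mnN Wa Wb.
elim: Wa lt_mnN => {m a} [x | m x a Wa _ | m a a' _ IHa _ IHa'] lt_mnN.
- exact: WordCons.
- rewrite mul_mul addSn; apply/WordCons/WordD; first by apply: IHN => //; lia.
  by rewrite addnC; apply: IHN => //; lia.
- by rewrite linearDl; apply: WordD; [exact: IHa | exact: IHa'].
Qed.

Lemma mprod_word_span (w : fmagma A) : word_span (fmagma_size w) (mprod w).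
Proof. by elim: w => [x | u Wu v Wv] /=; [exact: WordLetter | exact: word_spanM]. Qed.

Lemma word_span_power_ideal n m a :
  word_span m a -> (2 ^ n.+1 <= m.+1)%N -> power_ideal n a.
Proof.
move=> Wa; suff key xs : (2 ^ n.+1 <= (size xs + m).+1)%N ->
    power_ideal n (foldr (nalg_mul A) a xs) by exact: (key [::]).
elim: Wa xs => {m a} [x | m x a _ IHa | m a b _ IHa _ IHb] xs.
- by rewrite addn1; apply: word_power_ideal.
- by have := IHa (rcons xs x); rewrite -cats1 foldr_cat size_cat addn1 addnS.
- move=> le_m; rewrite foldr_mulD.
  by apply: PowerIdealD; [exact: IHa | exact: IHb].
Qed.

Lemma power_ideal_eq0 n a :
    (forall c ys, size ys = n -> foldr (@sym_mul k A) c ys = 0) ->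
  power_ideal n a -> a = 0.
Proof.
move=> nil; elim=> {a} [c ys /nil // | a b _ -> _ -> | a _ -> | x a _ ->].
- by rewrite addr0.
- by rewrite oppr0.
- by rewrite linear0r.
Qed.

(** The exponent 2^(n+2) exceeds by one the length 2^(n+2) - 1 given by
    [word_power_ideal]; this spares a truncated subtraction. *)
Lemma nil_mprod_eq0 n : [pchar k]%R =i pred0 ->
    (forall x, iter n (sym_mul x) x = 0) ->
  forall w : fmagma A, fmagma_size w = (2 ^ n.+2)%N -> mprod w = 0.
Proof.
move=> char0 nil w size_w; apply: (@power_ideal_eq0 n.+1).
  move=> c ys; apply: polarization => // x.
  by rewrite iterSr sym_mulC -sym_mul_iter nil sym_mul0r.
apply: (@word_span_power_ideal _ (2 ^ n.+2)); last by rewrite leqnSn.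
by rewrite -size_w; exact: mprod_word_span.
Qed.

End SymmetrizedProduct.

(** * The dual Leibniz algebra of polynomials under integration *)

Section Integral.
Variable k : fieldType.
Implicit Types (p q h : {poly k}).

(** The antiderivative without constant term: at i = 0 the coefficient is a
    quotient by zero, hence zero. *)
Definition integ p : {poly k} := \poly_(i < (size p).+1) (p`_i.-1 / i%:R).

Lemma coef_integ p i : (integ p)`_i = p`_i.-1 / i%:R.
Proof.
rewrite coef_poly ltnS; case: leqP => // lt_pi.
have le_p : (size p <= i.-1)%N by case: i lt_pi.
by rewrite nth_default ?mul0r.
Qed.

Fact integ_is_linear : linear integ.
Proof.
move=> c p q; apply/polyP => i; rewrite !(coefD, coefZ, coef_integ).
by rewrite mulrDl mulrA.
Qed.
HB.instance Definition _ := GRing.isLinear.Build k {poly k} {poly k} *:%R integ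
  integ_is_linear.

(** The integral of t^n h divided by t^(n+1). *)
Definition shifted_integ n h : {poly k} :=
  \poly_(d < size h) (h`_d / (n + d).+1%:R).

Lemma coef_shifted_integ n h d : (shifted_integ n h)`_d = h`_d / (n + d).+1%:R.
Proof. by rewrite coef_poly; case: ltnP => // le_d; rewrite nth_default ?mul0r. Qed.

Lemma integ_XnM n h : integ ('X^n * h) = 'X^(n.+1) * shifted_integ n h.
Proof.
apply/polyP => i; rewrite coef_integ !coefXnM coef_shifted_integ.
case: i => [|i] /=; first by rewrite invr0 mulr0.
by rewrite ltnS; case: ltnP => lt_in; rewrite ?mul0r // subSS subnKC.
Qed.

Hypothesis char0 : [pchar k]%R =i pred0.

Lemma deriv_integ p : (integ p)^`() = p.
Proof.
apply/polyP => i; rewrite coef_deriv coef_integ /= -[LHS]mulr_natr.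
by rewrite divfK ?natS_neq0.
Qed.

Lemma integ_deriv p : integ p^`() = p - (p`_0)%:P.
Proof.
apply/polyP => -[|i]; rewrite coef_integ coefB coefC /=.
  by rewrite invr0 mulr0 subrr.
by rewrite coef_deriv subr0 -[_ *+ _]mulr_natr mulfK ?natS_neq0.
Qed.

Lemma integ_by_parts p q : integ (p * integ q + q * integ p) = integ p * integ q.
Proof.
rewrite -[RHS]subr0 -[in X in _ - X]polyC0; have <- : (integ p * integ q)`_0 = 0.
  by rewrite coef0M coef_integ invr0 mulr0 mul0r.
by rewrite -integ_deriv derivM !deriv_integ (mulrC (integ p)).
Qed.

End Integral.

Section PolyAlgebra.
Variable k : fieldType.

Definition integ_mul (p q : {poly k}) : {poly k} := p * integ q.

Fact integ_mul_is_bilinear : bilinear_for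
  (GRing.Scale.Law.clone _ _ *:%R _) (GRing.Scale.Law.clone _ _ *:%R _) integ_mul.
Proof.
split=> [q c p p' | p c q q']; rewrite /integ_mul.
  by rewrite mulrDl -scalerAl.
by rewrite linearP mulrDr -scalerAr.
Qed.
HB.instance Definition _ := bilinear_isBilinear.Build k {poly k} {poly k} {poly k}
  _ _ integ_mul integ_mul_is_bilinear.

Definition poly_nalg : nalg k := Nalg integ_mul.

Lemma poly_dual_leibniz : [pchar k]%R =i pred0 -> dual_leibniz poly_nalg.
Proof.
by move=> char0 p q r; rewrite /= /integ_mul integ_by_parts // mulrA mulrAC.
Qed.

End PolyAlgebra.

(** * Rational functions regular at the natural numbers *)

Section Regular.
Variable k : fieldType.
Hypothesis char0 : [pchar k]%R =i pred0.
Implicit Types f g : nat -> k.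

(** The restrictions to the natural numbers of the rational functions that have
    no pole there. *)
Definition regular f := exists p q : {poly k},
  (forall s : nat, q.[s%:R] != 0) /\ forall s, f s = p.[s%:R] / q.[s%:R].

Lemma eq_regular f g : f =1 g -> regular f -> regular g.
Proof. by move=> fg [p [q [q0 fE]]]; exists p, q; split=> // s; rewrite -fg. Qed.

Lemma regular_const c : regular (fun=> c).
Proof.
by exists c%:P, 1; split=> s; rewrite !hornerE ?oner_neq0 // divr1.
Qed.

Lemma regularD f g : regular f -> regular g -> regular (fun s => f s + g s).
Proof.
move=> [p [q [q0 fE]]] [p' [q' [q'0 gE]]].
exists (p * q' + p' * q), (q * q'); split=> s; rewrite !hornerE ?mulf_neq0 //.
by rewrite fE gE addf_div.
Qed.

Lemma regularM f g : regular f -> regular g -> regular (fun s => f s * g s).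
Proof.
move=> [p [q [q0 fE]]] [p' [q' [q'0 gE]]].
exists (p * p'), (q * q'); split=> s; rewrite !hornerE ?mulf_neq0 //.
by rewrite fE gE mulf_div.
Qed.

Lemma regular_sum (I : Type) (r : seq I) (F : I -> nat -> k) :
  (forall i, regular (F i)) -> regular (fun s => \sum_(i <- r) F i s).
Proof.
move=> regF; elim: r => [|i r IH].
  by apply: eq_regular (regular_const 0) => s; rewrite big_nil.
by apply: eq_regular (regularD (regF i) IH) => s; rewrite big_cons.
Qed.

Lemma regular_natr : regular (fun s => s%:R).
Proof. by exists 'X, 1; split=> s; rewrite !hornerE ?oner_neq0 // divr1. Qed.

Lemma regular_invS d : regular (fun s => (s + d).+1%:R^-1).
Proof.
by exists 1, ('X + d.+1%:R%:P); split=> s; rewrite !hornerE -natrD addnS ?natS_neq0 //.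
Qed.

Lemma regular_eq0 f m :
  regular f -> (forall s, (m < s)%N -> f s = 0) -> f 0%N = 0.
Proof.
move=> [p [q [q0 fE]]] f0; suff p0 : p = 0 by rewrite fE p0 horner0 mul0r.
pose rs := [seq (s%:R : k) | s <- iota m.+1 (size p)].
apply: (@roots_geq_poly_eq0 _ p rs); last by rewrite size_map size_iota.
  apply/allP => _ /mapP[s /[!mem_iota] /andP[lt_ms _] ->].
  have := f0 s lt_ms; rewrite fE => /eqP.
  by rewrite mulf_eq0 invr_eq0 (negPf (q0 s)) orbF.
rewrite map_inj_uniq ?iota_uniq // => a b; exact: natr_injective.
Qed.
End Regular.

(** * Linear independence of iterated integrals *)

Section IteratedIntegrals.
Variable k : fieldType.
Hypothesis char0 : [pchar k]%R =i pred0.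
Implicit Types (F : nat -> {poly k}) (u : seq nat) (h : {poly k}).

Definition iter_integ F u : {poly k} :=
  foldr (fun i h => integ (F i * h)) 1 u.

Lemma coef0_iter_integ F u : (iter_integ F u)`_0 = (u == [::])%:R.
Proof. by case: u => [|i u]; rewrite /= ?coef1 // coef_integ invr0 mulr0. Qed.

(** For s > 0, this adds t^s to the antiderivative of the i-th integrand. *)
Definition perturb (i s : nat) F j : {poly k} :=
  F j + (j == i)%:R *: (s%:R *: 'X^(s.-1)).

(** The integral of s t^(s-1) h divided by t^s, extended to s = 0 by continuity:
    the constant term of h is multiplied by s / s, read as 1. *)
Definition head_variation (s : nat) h : {poly k} :=
  \poly_(d < size h) (if d is 0 then h`_d else h`_d * (s%:R / (s + d)%:R)).

Lemma coef_head_variation s h d : (head_variation s h)`_d =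
  if d is 0 then h`_d else h`_d * (s%:R / (s + d)%:R).
Proof.
rewrite coef_poly; case: ltnP => //.
by case: d => [|d] le_d; rewrite nth_default ?mul0r.
Qed.

Lemma integ_head_variation s h :
  integ (s.+1%:R *: 'X^s * h) = 'X^(s.+1) * head_variation s.+1 h.
Proof.
rewrite -scalerAl linearZ /= integ_XnM; apply/polyP => d.
rewrite coefZ !coefXnM coef_shifted_integ coef_head_variation.
case: ltnP => [|_]; first by rewrite mulr0.
case: (d - s.+1)%N => [|e]; first by rewrite addn0 mulrC divfK // natS_neq0.
by rewrite mulrCA addSn.
Qed.

Lemma head_variation0 h : head_variation 0 h = (h`_0)%:P.
Proof.
apply/polyP => d; rewrite coef_head_variation coefC.
by case: d => // d; rewrite mul0r mulr0.
Qed.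

(** The part of first order in t^s of the perturbed iterated integral, divided
    by t^s: either the outermost integrand is perturbed or an inner one. *)
Fixpoint variation (i s : nat) F u : {poly k} :=
  if u is j :: u' then
    (j == i)%:R *: head_variation s (iter_integ F u')
      + 'X * shifted_integ s (F j * variation i s F u')
  else 0.

(** The terms of order at least 2 in the perturbation are multiples of
    t^(2s).  The exponent is positive since only then does the added integrand
    s t^(s-1) integrate to t^s. *)
Lemma iter_integ_perturb i s F u : exists Z : {poly k},
  iter_integ (perturb i s.+1 F) u
    = iter_integ F u + 'X^(s.+1) * variation i s.+1 F u + 'X^(s.+1 + s.+1) * Z.
Proof.
elim: u => [|j u [Z IH]] /=; first by exists 0; rewrite !mulr0 !addr0.
set V := iter_integ F u in IH *; set R := variation _ _ _ u in IH *.
exists ('X * shifted_integ (s.+1 + s.+1) (F j * Z)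
  + (j == i)%:R * s.+1%:R *: shifted_integ (s + s.+1) (R + 'X^(s.+1) * Z)).
rewrite IH /perturb /=.
have -> : (F j + (j == i)%:R *: (s.+1%:R *: 'X^s))
      * (V + 'X^(s.+1) * R + 'X^(s.+1 + s.+1) * Z)
    = F j * V + ('X^(s.+1) * (F j * R) + 'X^(s.+1 + s.+1) * (F j * Z))
      + (j == i)%:R *: (s.+1%:R *: 'X^s * V
        + s.+1%:R *: ('X^(s + s.+1) * (R + 'X^(s.+1) * Z))).
  rewrite -!mul_polyC !exprD; ring.
rewrite !linearD /= !linearZ /= integ_head_variation !integ_XnM.
rewrite -/V -!mul_polyC !exprS !exprD polyCM !exprS; ring.
Qed.

Lemma regular_head_variation d h : regular (fun s => (head_variation s h)`_d).
Proof.
apply: (@eq_regular _ (fun s =>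
  if d is e.+1 then h`_d * (s%:R / (s + e).+1%:R) else h`_d)).
  by move=> s; rewrite coef_head_variation; case: d => // d; rewrite addnS.
case: d => [|d]; first exact: regular_const.
apply: regularM; first exact: regular_const.
by apply: regularM; [exact: regular_natr | exact: regular_invS].
Qed.

Lemma regular_variation i F u d : regular (fun s => (variation i s F u)`_d).
Proof.
elim: u d => [|j u IH] d.
  by apply: (@eq_regular _ (fun=> 0)) (regular_const 0) => s; rewrite coef0.
apply: (@eq_regular _ (fun s => (j == i)%:R * (head_variation s (iter_integ F u))`_d
   + if d is e.+1 then
       (\sum_(a < e.+1) (F j)`_a * (variation i s F u)`_(e - a)) / (s + e).+1%:R
     else 0)).
  move=> s; rewrite /= coefD coefZ coefXM.
  by case: d => //= d; rewrite coef_shifted_integ coefM.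
apply: regularD.
  by apply: regularM; [exact: regular_const | exact: regular_head_variation].
case: d => [|d]; first exact: regular_const.
apply: regularM; last exact: regular_invS.
by apply: regular_sum => a; apply: regularM => //; exact: regular_const.
Qed.

(** At s = 0 the perturbed integrand contributes the constant term of the inner
    integral, which vanishes unless it is taken over the empty word: only the
    last letter counts. *)
Lemma variation0_rcons i F u j :
  variation i 0 F (rcons u j) = (j == i)%:R *: iter_integ F u.
Proof.
have shift0 h : 'X * shifted_integ 0 h = integ h.
  by rewrite -[in RHS](mul1r h) -(expr0 'X) integ_XnM expr1.
elim: u => [|a u IH] /=.
  by rewrite head_variation0 coef1 /= mulr0 shift0 linear0 addr0.
rewrite head_variation0 coef0_iter_integ shift0 IH.
have -> : (rcons u j == [::]) = false by case: (u).
by rewrite polyC0 scaler0 add0r -scalerAr linearZ.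
Qed.

(** Subtracting the relation at F from the perturbed one leaves a multiple of
    t^(2s) besides t^s times the combined variation.  So the coefficient of t^d
    in the combined variation vanishes for s > d, hence for s = 0. *)
Lemma variation0_relation (q : seq (k * seq nat)) :
    (forall F, \sum_(x <- q) x.1 *: iter_integ F x.2 = 0) ->
  forall i F, \sum_(x <- q) x.1 *: variation i 0 F x.2 = 0.
Proof.
move=> q0 i F; apply/polyP => d; rewrite coef0.
pose f s := (\sum_(x <- q) x.1 *: variation i s F x.2)`_d.
apply: (@regular_eq0 _ char0 f d).
  apply: (@eq_regular _ (fun s => \sum_(x <- q) x.1 * (variation i s F x.2)`_d)).
    by move=> s; rewrite /f coef_sum; apply: eq_bigr => x _; rewrite coefZ.
  apply: regular_sum => x; apply: regularM; first exact: regular_const.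
  exact: regular_variation.
case=> // s lt_ds.
have [Z ZE] : exists Z, \sum_(x <- q) x.1 *: iter_integ (perturb i s.+1 F) x.2 =
    \sum_(x <- q) x.1 *: iter_integ F x.2
    + 'X^(s.+1) * ((\sum_(x <- q) x.1 *: variation i s.+1 F x.2) + 'X^(s.+1) * Z).
  elim: (q) => [|x r [Z IH]].
    by exists 0; rewrite !big_nil mulr0 add0r add0r mulr0.
  have [Z' Z'E] := iter_integ_perturb i s F x.2.
  exists (x.1 *: Z' + Z); rewrite !big_cons IH Z'E -!mul_polyC exprD; ring.
move: ZE; rewrite !q0 add0r => /esym/eqP.
rewrite mulf_eq0 expf_eq0 /= polyX_eq0 /= addr_eq0 => /eqP E.
by rewrite /f E coefN coefXnM lt_ds oppr0.
Qed.

(** Words are read backwards, so that deleting the last letter, which is the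
    effect of the variation at s = 0, becomes the removal of a head. *)
Lemma iter_integ_independent (w : seq nat) (q : seq (k * seq nat)) :
    (forall F, \sum_(x <- q) x.1 *: iter_integ F (rev x.2) = 0) ->
  \sum_(x <- q | x.2 == w) x.1 = 0.
Proof.
elim: w q => [|i w IH] q q0.
  have := congr1 (fun p : {poly k} => p`_0) (q0 (fun=> 0)).
  rewrite coef0 coef_sum => E; rewrite -[RHS]E big_mkcond; apply: eq_bigr => x _.
  rewrite coefZ coef0_iter_integ -[rev _ == _](inj_eq (can_inj revK)) revK.
  by case: eqP; rewrite ?mulr1 ?mulr0.
pose r := [seq (x.1, behead x.2) | x <- q & ohead x.2 == Some i].
have := IH r; rewrite big_map big_filter_cond /=.
rewrite (eq_bigl (fun x : k * seq nat => x.2 == i :: w)); last first.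
  by case=> c [|j u] //=; rewrite eqseq_cons.
apply=> F; rewrite big_map big_filter /= big_mkcond /=.
pose q' := [seq (x.1, rev x.2) | x <- q].
have := @variation0_relation q' _ i F; rewrite big_map /= => q'0.
rewrite -[RHS]q'0 => [|G]; last by rewrite big_map; exact: q0.
apply: eq_bigr => -[c [|j u]] _ /=; first by rewrite scaler0.
rewrite rev_cons variation0_rcons.
rewrite -[Some j == Some i]/(j == i).
by case: eqP => _; rewrite ?scale1r // scale0r scaler0.
Qed.
End IteratedIntegrals.

(** * Identities as combinations of words *)

(** The right-normed product of the nonempty word i :: u; keeping its head apart
    avoids a value for the empty word. *)
Fixpoint word_prod (k : fieldType) (A : nalg k) (v : nat -> A) i u : A :=
  if u is j :: u' then nalg_mul A (v i) (word_prod v j u') else v i.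

Section NormalForm.
Variable k : fieldType.
Implicit Types A : nalg k.
Local Notation word := (nat * seq nat)%type.

(** The lists of words obtained here and in the next two lemmas do not depend on
    the algebra: this is what carries relations from one algebra to another. *)
Lemma word_prodM (x y : word) : {s : seq word |
  forall A (v : nat -> A), dual_leibniz A ->
  nalg_mul A (word_prod v x.1 x.2) (word_prod v y.1 y.2)
    = \sum_(z <- s) word_prod v z.1 z.2}.
Proof.
have [n] := ubnP (size x.2 + size y.2).
elim: n x y => // n IH [i [|j u]] [a w] /= lt_n.
  by exists [:: (i, a :: w)] => A v _; rewrite big_seq1.
have [s sE] := IH (j, u) (a, w) ltac:(rewrite /=; lia).
have [t tE] := IH (a, w) (j, u) ltac:(rewrite /=; lia).
exists [seq (i, z.1 :: z.2) | z <- s ++ t] => A v dlA.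
rewrite big_map /= mul_mul // /sym_mul sE // tE // -big_cat linear_sumr.
by apply: eq_bigr => -[].
Qed.

Lemma mprod_words (w : fmagma nat) : {s : seq word |
  forall A (v : nat -> A), dual_leibniz A ->
  mprod (fmagma_map v w) = \sum_(z <- s) word_prod v z.1 z.2}.
Proof.
elim: w => [i | w1 [s1 E1] w2 [s2 E2]] /=.
  by exists [:: (i, [::])] => A v _; rewrite big_seq1.
exists (flatten [seq sval (word_prodM x y) | x <- s1, y <- s2]) => A v dlA.
rewrite E1 // E2 // linear_sumlz big_flatten big_allpairs_dep /=; apply: eq_bigr => x _.
rewrite linear_sumr; apply: eq_bigr => y _.
by case: word_prodM => s /= ->.
Qed.

Lemma naeval_words (p : napoly k) : exists q : seq (k * word),
  forall A (v : nat -> A), dual_leibniz A ->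
  naeval v p = \sum_(x <- q) x.1 *: word_prod v x.2.1 x.2.2.
Proof.
exists (flatten [seq [seq (p@_w, z) | z <- sval (mprod_words w)] | w <- msupp p]).
move=> A v dlA; rewrite big_flatten big_map; apply: eq_bigr => w _.
by rewrite big_map; case: mprod_words => s /= ->; rewrite // scaler_sumr.
Qed.

Lemma sum_eq0_by_class (T : eqType) (V : lmodType k) (q : seq (k * T)) (g : T -> V) :
    (forall y, \sum_(x <- q | x.2 == y) x.1 = 0) ->
  \sum_(x <- q) x.1 *: g x.2 = 0.
Proof.
move=> q0; pose r := undup [seq x.2 | x <- q].
transitivity (\sum_(x <- q) \sum_(y <- r | x.2 == y) x.1 *: g y).
  rewrite [LHS]big_seq [RHS]big_seq; apply: eq_bigr => x qx.
  have rx : x.2 \in r by rewrite mem_undup map_f.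
  rewrite big_mkcond (bigD1_seq x.2) ?undup_uniq //= eqxx big1 ?addr0 // => y.
  by rewrite eq_sym => /negPf ->.
rewrite (exchange_big_dep xpredT) //= big1 // => y _.
by rewrite -scaler_suml q0 scale0r.
Qed.

Lemma word_prod_poly (F : nat -> poly_nalg k) i u :
  word_prod F i u = (F i : {poly k}) * iter_integ F u.
Proof. by elim: u i => [|j u IH] i /=; rewrite ?mulr1 // IH. Qed.

(** An identity of the polynomial algebra, written in words and integrated once,
    is a relation between iterated integrals; so the coefficients of each word
    add up to zero, and the identity holds everywhere. *)
Lemma poly_nalg_generates (p : napoly k) : [pchar k]%R =i pred0 ->
  satisfies (poly_nalg k) p -> forall A, dual_leibniz A -> satisfies A p.
Proof.
move=> char0 Pp A dlA v; have [q qE] := naeval_words p; rewrite qE //.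
apply: (sum_eq0_by_class (fun y => word_prod v y.1 y.2)) => -[i u].
pose r := [seq (x.1, rev (x.2.1 :: x.2.2)) | x <- q].
have := @iter_integ_independent _ char0 (rev (i :: u)) r.
rewrite big_map /= (eq_bigl (fun x : k * word => x.2 == (i, u))); last first.
  by move=> [c [j w]] /=; rewrite (inj_eq (can_inj revK)) eqseq_cons.
apply=> F; rewrite big_map /=.
have := congr1 (@integ k) (Pp F); rewrite linear0 qE; last exact: poly_dual_leibniz.
move=> E; rewrite -[RHS]E linear_sum; apply: eq_bigr => x _.
by rewrite linearZ revK word_prod_poly.
Qed.
End NormalForm.

(** * From one polynomial relation to a nil identity *)

Section OneGenerator.
Variables (k : fieldType) (char0 : [pchar k]%R =i pred0).
Variables (A : nalg k) (dlA : dual_leibniz A).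
Local Notation "x ** y" := (nalg_mul A x y) (at level 40, left associativity).
Local Notation "x +* y" := (sym_mul x y) (at level 40, left associativity).

Definition sym_pow (x : A) n : A := iter n (sym_mul x) x.

Lemma sym_pow_mul x m n : sym_pow x m +* sym_pow x n = sym_pow x (m + n).+1.
Proof.
rewrite {2}/sym_pow sym_mul_iter // (sym_mulC _ x).
by rewrite -[x +* _]/(sym_pow x m.+1) -iterD addnS addnC.
Qed.

(** With X_n the power of x with n+1 factors, X_n x = (n+1) (x X_{n-1}) x
    = (n+1) x X_n by induction, whence X_{n+1} = x X_n + X_n x = (n+2) x X_n. *)
Lemma mul_sym_pow1 x n :
  x ** sym_pow x n *+ n.+2 = sym_pow x n.+1.
Proof.
elim: n => [|n IH]; first by rewrite mulr2n.
have -> : sym_pow x n.+2 = x ** sym_pow x n.+1 + sym_pow x n.+1 ** x by [].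
rewrite mulrS; congr (_ + _).
by rewrite -[in RHS]IH linearMnl mul_mul // (sym_mulC _ x).
Qed.

Lemma mul_sym_pow x m n :
  sym_pow x m ** sym_pow x n *+ (m + n).+2 = sym_pow x (m + n).+1 *+ m.+1.
Proof.
case: m => [|m]; first exact: mul_sym_pow1.
rewrite -(mul_sym_pow1 x m) linearMnl mul_mul // sym_pow_mul mulrnAC.
by rewrite -addSn mul_sym_pow1.
Qed.

Lemma sym_powZ c x n : sym_pow (c *: x) n = c ^+ n.+1 *: sym_pow x n.
Proof.
elim: n => [|n IH]; first by rewrite expr1.
by rewrite /sym_pow iterS -/(sym_pow _ n) IH sym_mulZl sym_mulZr scalerA -exprS.
Qed.

(** The factor 1/(n+1) appears because t^n stands for its antiderivative
    t^(n+1)/(n+1), and this is where t^(n+1) goes to the power with n+1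
    factors. *)
Definition poly_subst (x : A) (p : {poly k}) : A :=
  \sum_(i < size p) (p`_i / i.+1%:R) *: sym_pow x i.

Lemma poly_subst_wide x n (p : {poly k}) : (size p <= n)%N ->
  poly_subst x p = \sum_(i < n) (p`_i / i.+1%:R) *: sym_pow x i.
Proof.
move=> le_n; rewrite /poly_subst.
rewrite (big_ord_widen _ (fun i => (p`_i / i.+1%:R) *: sym_pow x i) le_n).
rewrite big_mkcond; apply: eq_bigr => i _; case: ltnP => // le_p.
by rewrite nth_default // mul0r scale0r.
Qed.

Fact poly_subst_is_linear x : linear (poly_subst x).
Proof.
move=> c p q; pose n := maxn (size p) (size q).
have le_n : (size (c *: p + q)%R <= n)%N.
  rewrite (leq_trans (size_polyD _ _)) // geq_max leq_maxr andbT.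
  by rewrite (leq_trans (size_scale_leq _ _)) // leq_maxl.
rewrite !(@poly_subst_wide _ n) ?leq_maxl ?leq_maxr // scaler_sumr -big_split.
by apply: eq_bigr => i _; rewrite /= coefD coefZ mulrDl scalerDl scalerA mulrA.
Qed.
HB.instance Definition _ x := GRing.isLinear.Build k {poly k} A *:%R (poly_subst x)
  (poly_subst_is_linear x).

Lemma poly_substXn x n : poly_subst x 'X^n = n.+1%:R^-1 *: sym_pow x n.
Proof.
rewrite /poly_subst size_polyXn big_ord_recr /= big1 ?add0r => [|i _].
  by rewrite coefXn eqxx mul1r.
by rewrite coefXn ltn_eqF // mul0r scale0r.
Qed.

Lemma poly_substM x p q :
  poly_subst x (integ_mul p q) = poly_subst x p ** poly_subst x q.
Proof.
have monomials m n : poly_subst x (integ_mul 'X^m 'X^n)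
    = poly_subst x 'X^m ** poly_subst x 'X^n.
  have -> : integ_mul 'X^m 'X^n = n.+1%:R^-1 *: 'X^((m + n).+1) :> {poly k}.
    rewrite /integ_mul -['X^n]mulr1 integ_XnM -addnS exprD [RHS]scalerAr.
    congr (_ * _); apply/polyP => d; rewrite coefZ coefXnM coefXn.
    rewrite coef_shifted_integ coef1; case: ltngtP => [_|lt_d|->].
    - by rewrite mulr0.
    - by rewrite subn_eq0 leqNgt lt_d mul0r mulr0.
    - by rewrite subnn addn0 div1r mulr1.
  rewrite linearZ /= !poly_substXn linearZl_LR linearZr_LR /= !scalerA.
  have /(congr1 (fun z => (m + n).+2%:R^-1 *: z)) := mul_sym_pow x m n.
  rewrite -[in LHS]scaler_nat scalerA mulVf ?natS_neq0 // scale1r => ->.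
  rewrite -[in RHS]scaler_nat !scalerA; congr (_ *: _).
  by rewrite [RHS]mulrC !mulrA mulfV ?natS_neq0 // mul1r.
rewrite -[p]coefK -[q]coefK !poly_def.
have subst_sum I (r : seq I) (G : I -> {poly k}) :
    poly_subst x (\sum_(i <- r) G i) = \sum_(i <- r) poly_subst x (G i).
  exact: linear_sum.
rewrite linear_sumlz !subst_sum linear_sumlz; apply: eq_bigr => i _.
rewrite linear_sumr subst_sum linear_sumr; apply: eq_bigr => j _.
transitivity (poly_subst x (p`_i *: (q`_j *: integ_mul 'X^i 'X^j))).
  by congr (poly_subst x _); rewrite /= /integ_mul -scalerAl linearZ -scalerAr.
by rewrite !linearZ /= linearZl_LR scalerA mulrC -scalerA monomials.
Qed.

Lemma naeval_poly_subst x (F : nat -> poly_nalg k) (p : napoly k) :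
  naeval (fun i => poly_subst x (F i)) p = poly_subst x (naeval F p).
Proof.
rewrite /naeval linear_sum; apply: eq_bigr => w _; rewrite linearZ; congr (_ *: _).
by elim: w => //= u -> v ->; rewrite poly_substM.
Qed.

(** Replacing x by m x multiplies the term of degree i by m^(i+1); shifting the
    index makes this a relation polynomial in m without constant term. *)
Lemma nil_of_relation (g : {poly k}) : g != 0 ->
  (forall x, poly_subst x g = 0) -> forall x, sym_pow x (size g).-1 = 0.
Proof.
move=> g0 rel x.
pose H j := if j is i.+1 then (g`_i / i.+1%:R) *: sym_pow x i else 0.
have lt_g : ((size g).-1 < size g)%N by rewrite prednK // size_poly_gt0.
have : H (size g).-1.+1 = 0.
  apply: (@vanishing_coefs k char0 A (size g).+1); last by [].
  move=> m; rewrite -[RHS](rel (m%:R *: x)) big_ord_recl scaler0 add0r.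
  by apply: eq_bigr => i _; rewrite /= sym_powZ !scalerA mulrC.
move=> /= /eqP; rewrite scaler_eq0 mulf_eq0 invr_eq0 (negPf (natS_neq0 char0 _)) orbF.
by rewrite -lead_coefE lead_coef_eq0 (negPf g0) => /eqP.
Qed.

End OneGenerator.

Theorem theorem2 (k : fieldType) (char0 : [pchar k]%R =i pred0)
    (M : nalg k -> Prop) (HM : proper_subvariety M (@dual_leibniz k)) :
  nilpotent_variety M.
Proof.
have [[I MI] M_dl M_neq] := HM.
have [p Ip notPp] : exists2 p, I p & ~ satisfies (poly_nalg k) p.
  apply: NNPP => no_p; apply: M_neq => A; split=> [dlA | /M_dl //].
  apply/MI => p Ip; apply: poly_nalg_generates => //.
  by apply: NNPP => notPp; apply: no_p; exists p.
have [F /eqP g0] := not_all_ex_not _ _ notPp.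
set g := naeval F p in g0.
exists (2 ^ (size (g : {poly k})).-1.+2)%N; first by rewrite expn_gt0.
move=> A MA; have dlA := M_dl A MA.
apply: nil_mprod_eq0 => //; apply: (nil_of_relation char0 g0) => x.
rewrite -naeval_poly_subst //; exact: ((MI A).1 MA p Ip).
Qed.
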